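(* Let $K$ be a field of characteristic zero and $n\geq 1$. The following two assertions are equivalent: ($\mathrm{DC}_n$) Every $K$-algebra endomorphism of the $n$th Weyl algebra $A_n$ over $K$ is an automorphism. ($\mathrm{HDC}_n^{\leq n}$) For every $m\in\{0,1,\ldots,n\}$ and all $k,k'\in K^n$ both containing exactly $m$ nonzero elements, every nonzero hom-associative $K$-algebra homomorphism $A_n^k\to A_n^{k'}$ is an isomorphism of hom-associative $K$-algebras.
   Context: The $n$th Weyl algebra $A_n$ over $K$ is the free associative unital $K$-algebra on $x_1,\ldots,x_n,y_1,\ldots,y_n$ modulo the relations $[x_i,x_j]=[y_i,y_j]=0$ and $[x_i,y_j]=\delta_{ij}$ (Kronecker delta, times $1_{A_n}$) for $1\le i,j\le n$. $K$-algebra endomorphisms of $A_n$ are assumed to respect the identity element. For $k=(k_1,\ldots,k_n)\in K^n$, let $\widehat\alpha_k\colon A_n\to A_n$ be the unital $K$-algebra endomorphism with $\widehat\alpha_k(x_\ell)=x_\ell$ and $\widehat\alpha_k(y_\ell)=y_\ell+k_\ell$ for $1\le\ell\le n$. The $n$th hom-associative Weyl algebra $A_n^k$ is the $K$-vector space $A_n$ equipped with the (in general nonassociative, nonunital) multiplication $p*q:=\widehat\alpha_k(pq)$ (where $pq$ is the product in $A_n$) and with twisting map $\widehat\alpha_k$. A homomorphism of hom-associative $K$-algebras $\varphi\colon A\to B$, with twisting maps $\alpha_A,\alpha_B$, is a $K$-linear multiplicative map with $\varphi\circ\alpha_A=\alpha_B\circ\varphi$; an isomorphism is a bijective homomorphism.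 *)

(* Defs.v *)
From HB Require Import structures.
From mathcomp Require Import all_boot all_order all_algebra.
From mathcomp Require Import boolp finmap.
From mathcomp.multinomials Require mpoly.

Set Implicit Arguments.
Unset Strict Implicit.
Unset Printing Implicit Defensive.

Import GRing.Theory.
Local Open Scope ring_scope.
Local Open Scope quotient_scope.

(* K[X_1, ..., X_n] with d/dX_i and multiplication by X_i satisfies the Weyl
   relations; it serves to show that the Weyl algebra is not the zero ring. *)
Module PolyRep.
Import -(notations) mpoly.

Section PolyRep.
Variables (K : fieldType) (n : nat).

Definition polyX (i : 'I_n) (v : mpoly n K) : mpoly n K := mderiv i v.
Definition polyY (i : 'I_n) (v : mpoly n K) : mpoly n K := mpolyX K (mnm1 i) * v.

Fact polyX_linear i : linear (polyX i).
Proof. exact: mderiv_is_linear. Qed.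
HB.instance Definition _ i :=
  GRing.isLinear.Build K (mpoly n K) (mpoly n K) *:%R (polyX i) (polyX_linear i).

Fact polyY_linear i : linear (polyY i).
Proof. by move=> c u v; rewrite /polyY mulrDr scalerAr. Qed.
HB.instance Definition _ i :=
  GRing.isLinear.Build K (mpoly n K) (mpoly n K) *:%R (polyY i) (polyY_linear i).

Lemma polyXX i j v : polyX i (polyX j v) = polyX j (polyX i v).
Proof. exact: mderiv_comm. Qed.

Lemma polyYY i j v : polyY i (polyY j v) = polyY j (polyY i v).
Proof. exact: mulrCA. Qed.

Lemma polyXY i j v : polyX i (polyY j v) - polyY j (polyX i v) = v *+ (i == j).
Proof.
rewrite /polyX mderivM addrK mderivX mnm1E eq_sym.
have [->|_] := eqVneq i j; last by rewrite scale0r mul0r.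
rewrite scale1r (_ : mnm_sub _ _ = mnm0) ?mpolyX0 ?mul1r //.
by apply/mnmP => k; rewrite mnmBE mnm0E subnn.
Qed.

Lemma weyl_rep :
  exists (V : lmodType K) (X Y : 'I_n -> {linear V -> V}),
  [/\ exists v : V, v != 0,
      forall i j v, X i (X j v) = X j (X i v),
      forall i j v, Y i (Y j v) = Y j (Y i v)
    & forall i j v, X i (Y j v) - Y j (X i v) = v *+ (i == j)].
Proof.
exists (mpoly n K), (fun i => polyX i), (fun i => polyY i); split.
- by exists 1; exact: oner_neq0.
- exact: polyXX.
- exact: polyYY.
- exact: polyXY.
Qed.
End PolyRep.
End PolyRep.

From mathcomp.multinomials Require Import monalg.

Definition comm_br (A : pzRingType) (a b : A) : A := a * b - b * a.

Section Ideals.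
Variable F : nzRingType.

Definition two_sided_ideal (I : F -> Prop) : Prop :=
  [/\ I 0,
      forall p q, I p -> I q -> I (p - q)
    & forall a b p, I p -> I (a * p * b)].

Definition gen_ideal (S : F -> Prop) (p : F) : Prop :=
  forall I : F -> Prop,
    two_sided_ideal I -> (forall r, S r -> I r) -> I p.

Lemma gen_idealP (S : F -> Prop) : two_sided_ideal (gen_ideal S).
Proof.
split=> [I|p q Sp Sq I|a b p Sp I] idI SI.
- by case: idI.
- by have [_ IB _] := idI; apply: IB; [apply: Sp | apply: Sq].
- by have [_ _ IM] := idI; apply: IM; apply: Sp.
Qed.

Lemma gen_ideal_sub (S : F -> Prop) r : S r -> gen_ideal S r.
Proof. by move=> Sr I _; apply. Qed.

End Ideals.

Section FreeAlgebra.
Variables (K : fieldType) (T : choiceType).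

(* Free associative unital algebra on T: the monoid algebra of the free
   monoid of words on T. *)
Definition free_alg : Type := {malg K[{fmonom T}]}.
Local Notation M := {malg K[{fmonom T}]}.

(* The operations are locked: unification would otherwise unfold products of
   finitely supported functions. *)
Definition free_add : free_alg -> free_alg -> free_alg := locked (@GRing.add M).
Definition free_opp : free_alg -> free_alg := locked (@GRing.opp M).
Definition free_mul : free_alg -> free_alg -> free_alg := locked (@GRing.mul M).
Definition free_scale : K -> free_alg -> free_alg := locked (@GRing.scale K M).

HB.instance Definition _ := Choice.copy free_alg M.

Fact free_addA : associative free_add.
Proof. by rewrite /free_add -lock; exact: addrA. Qed.
Fact free_addC : commutative free_add.
Proof. by rewrite /free_add -lock; exact: addrC. Qed.
Fact free_add0 : left_id (0 : M) free_add.
Proof. by rewrite /free_add -lock; exact: add0r. Qed.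
Fact free_addN : left_inverse (0 : M) free_opp free_add.
Proof. by rewrite /free_add /free_opp -!lock; exact: addNr. Qed.
HB.instance Definition _ := GRing.isZmodule.Build free_alg
  free_addA free_addC free_add0 free_addN.

Lemma free_addE (p q : free_alg) : p + q = (p : M) + (q : M) :> M.
Proof. by rewrite [LHS]/(free_add p q) /free_add -lock. Qed.

Lemma free_subE (p q : free_alg) : p - q = (p : M) - (q : M) :> M.
Proof.
by rewrite free_addE [X in _ + X]/(free_opp q) /free_opp -lock.
Qed.

Fact free_mulA : associative free_mul.
Proof. by rewrite /free_mul -lock; exact: mulrA. Qed.
Fact free_mul1 : left_id (1 : M) free_mul.
Proof. by rewrite /free_mul -lock; exact: mul1r. Qed.
Fact free_mulr1 : right_id (1 : M) free_mul.
Proof. by rewrite /free_mul -lock; exact: mulr1. Qed.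
Fact free_mulDl : left_distributive free_mul (+%R : free_alg -> _).
Proof.
by move=> p q r; rewrite !free_addE /free_mul -lock; exact: mulrDl.
Qed.
Fact free_mulDr : right_distributive free_mul (+%R : free_alg -> _).
Proof.
by move=> p q r; rewrite !free_addE /free_mul -lock; exact: mulrDr.
Qed.
Fact free_1_neq0 : (1 : M) != (0 : free_alg).
Proof. exact: (oner_neq0 M). Qed.
HB.instance Definition _ := GRing.Zmodule_isNzRing.Build free_alg
  free_mulA free_mul1 free_mulr1 free_mulDl free_mulDr free_1_neq0.

Lemma free_mulE (p q : free_alg) : p * q = (p : M) * (q : M) :> M.
Proof. by rewrite [LHS]/(free_mul p q) /free_mul -lock. Qed.

Fact free_scaleA c d p : free_scale c (free_scale d p) = free_scale (c * d) p.
Proof. by rewrite /free_scale -lock; exact: scalerA. Qed.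
Fact free_scale1 : left_id 1 free_scale.
Proof. by rewrite /free_scale -lock; exact: scale1r. Qed.
Fact free_scaleDr : right_distributive free_scale (+%R : free_alg -> _).
Proof.
by move=> c p q; rewrite !free_addE /free_scale -lock; exact: scalerDr.
Qed.
Fact free_scaleDl (p : free_alg) : {morph free_scale^~ p : c d / c + d}.
Proof.
by move=> c d; rewrite free_addE /free_scale -lock; exact: scalerDl.
Qed.
HB.instance Definition _ := GRing.Zmodule_isLmodule.Build K free_alg
  free_scaleA free_scale1 free_scaleDr free_scaleDl.

Lemma free_scaleE c (p : free_alg) : c *: p = c *: (p : M) :> M.
Proof. by rewrite [LHS]/(free_scale c p) /free_scale -lock. Qed.

Fact free_scaleAl (c : K) (p q : free_alg) : c *: (p * q) = c *: p * q.
Proof. by rewrite !free_mulE !free_scaleE scalerAl. Qed.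
HB.instance Definition _ :=
  GRing.Lmodule_isLalgebra.Build K free_alg free_scaleAl.

Fact free_scaleAr (c : K) (p q : free_alg) : c *: (p * q) = p * (c *: q).
Proof.
have centr (g : M) : c *: g = g * c%:MP.
  apply/malgP=> m; rewrite mcoeffZ [g]monalgE mulr_suml !raddf_sum mulr_sumr.
  apply: eq_bigr => i _ /=.
  by rewrite malgM_def fgmulUU mulm1 !mcoeffU mulrnAr [c * _]mulrC.
rewrite !free_mulE !free_scaleE.
by apply: etrans (centr _) _; apply: etrans (esym (mulrA _ _ _)) _; rewrite -centr.
Qed.
HB.instance Definition _ :=
  GRing.Lalgebra_isAlgebra.Build K free_alg free_scaleAr.

Definition free_gen : T -> free_alg := locked (fun t => << fmu t >> : M).

Section Eval.
Variables (B : algType K) (h : T -> B).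

Definition word_ev (w : {fmonom T}) : B := \prod_(t <- w) h t.

Fact word_ev_mmorphism : mmorphism word_ev.
Proof.
by split=> [v w|]; rewrite /word_ev ?fmM ?big_cat // fm1 big_nil.
Qed.
HB.instance Definition _ :=
  isMultiplicative.Build {fmonom T} B word_ev word_ev_mmorphism.

Definition free_ev (p : free_alg) : B := mmap (in_alg B) word_ev p.

Fact free_ev_is_zmod_morphism : zmod_morphism free_ev.
Proof. by move=> p q; rewrite free_subE /free_ev raddfB. Qed.
HB.instance Definition _ :=
  GRing.isZmodMorphism.Build free_alg B free_ev free_ev_is_zmod_morphism.

Fact free_ev_is_monoid_morphism : monoid_morphism free_ev.
Proof.
have [|evM ev1] := @commr_mmap_is_multiplicative _ _ _ (in_alg B) word_ev.
  by move=> g m m'; rewrite /GRing.comm /= mulr_algl mulr_algr.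
by split=> // p q; rewrite free_mulE; exact: evM.
Qed.
HB.instance Definition _ :=
  GRing.isMonoidMorphism.Build free_alg B free_ev free_ev_is_monoid_morphism.

Fact free_ev_is_scalable : scalable free_ev.
Proof. by move=> c p; rewrite free_scaleE /free_ev mmapZ /= mulr_algl. Qed.
HB.instance Definition _ :=
  GRing.isScalable.Build K free_alg B *:%R free_ev free_ev_is_scalable.

Lemma free_ev_gen t : free_ev (free_gen t) = h t.
Proof.
by rewrite /free_gen -lock /free_ev mmapU /= scale1r mul1r /word_ev fmU big_seq1. Qed.

End Eval.
End FreeAlgebra.

Section WeylAlgebra.
Variables (K : fieldType) (n : nat).

(* inl i stands for x_i and inr i for y_i *)
Local Notation F := (free_alg K ('I_n + 'I_n)%type).

Definition free_x (i : 'I_n) : F := free_gen K (inl i).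
Definition free_y (i : 'I_n) : F := free_gen K (inr i).

Inductive weyl_rel : F -> Prop :=
| weyl_rel_xx i j : weyl_rel (comm_br (free_x i) (free_x j))
| weyl_rel_yy i j : weyl_rel (comm_br (free_y i) (free_y j))
| weyl_rel_xy i j : weyl_rel (comm_br (free_x i) (free_y j) - (i == j)%:R).

Definition weyl_ideal (p : F) : bool := `[< gen_ideal weyl_rel p >].

Lemma weyl_idealP p : reflect (gen_ideal weyl_rel p) (p \in weyl_ideal).
Proof. exact: asboolP. Qed.

Fact weyl_ideal_zmod : zmod_closed weyl_ideal.
Proof.
have [I0 IB _] := gen_idealP weyl_rel.
split=> [|p q]; first exact/weyl_idealP.
by move=> /weyl_idealP Ip /weyl_idealP Iq; apply/weyl_idealP; exact: IB Ip Iq.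
Qed.
HB.instance Definition _ := GRing.isZmodClosed.Build F weyl_ideal weyl_ideal_zmod.

Lemma weyl_idealM a b p : p \in weyl_ideal -> a * p * b \in weyl_ideal.
Proof.
have [_ _ IM] := gen_idealP weyl_rel.
by move=> /weyl_idealP Ip; apply/weyl_idealP; exact: IM Ip.
Qed.

Lemma weyl_idealMl a p : p \in weyl_ideal -> a * p \in weyl_ideal.
Proof. by move/(weyl_idealM a 1); rewrite mulr1. Qed.

Lemma weyl_idealMr b p : p \in weyl_ideal -> p * b \in weyl_ideal.
Proof. by move/(weyl_idealM 1 b); rewrite mul1r. Qed.

Lemma weyl_idealZ c p : p \in weyl_ideal -> c *: p \in weyl_ideal.
Proof. by move=> Ip; rewrite -[p]mul1r scalerAl weyl_idealMl. Qed.

Section Action.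
Variables (V : lmodType K) (X Y : 'I_n -> {linear V -> V}).
Hypothesis XX : forall i j v, X i (X j v) = X j (X i v).
Hypothesis YY : forall i j v, Y i (Y j v) = Y j (Y i v).
Hypothesis XY : forall i j v, X i (Y j v) - Y j (X i v) = v *+ (i == j).

Definition gen_act (t : 'I_n + 'I_n) : {linear V -> V} :=
  match t with inl i => X i | inr i => Y i end.

Definition word_act (w : seq ('I_n + 'I_n)) (v : V) : V := foldr gen_act v w.

Definition free_act (v : V) (p : F) : V :=
  \sum_(w <- msupp p) p@_w *: word_act w v.

Lemma free_actEw (d : {fset {fmonom ('I_n + 'I_n)%type}}) v p :
  (msupp p `<=` d)%fset -> free_act v p = \sum_(w <- d) p@_w *: word_act w v.
Proof.
move=> le; rewrite [LHS](big_fset_incl _ le) => //= w _ /mcoeff_outdom ->.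
by rewrite scale0r.
Qed.

Lemma free_actB v p q : free_act v (p - q) = free_act v p - free_act v q.
Proof.
rewrite free_subE; set d := (msupp p `|` msupp q)%fset.
rewrite !(@free_actEw d) ?fsubsetUl ?fsubsetUr ?msuppB_le //.
by rewrite -sumrB; apply: eq_bigr => w _; rewrite mcoeffB scalerBl.
Qed.

Lemma free_act0 v : free_act v 0 = 0.
Proof. by rewrite -(subrr 0) free_actB subrr. Qed.

Lemma free_act_sum v (I : Type) (r : seq I) (G : I -> F) :
  free_act v (\sum_(i <- r) G i) = \sum_(i <- r) free_act v (G i).
Proof.
have D p q : free_act v (p + q) = free_act v p + free_act v q.
  by rewrite -{1}[q]opprK -{1}[- q]add0r !free_actB free_act0 add0r opprK.
by elim/big_rec2: _ => [|i y1 y2 _ <-]; rewrite ?free_act0 ?D.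
Qed.

Lemma free_sumE (I : Type) (r : seq I) (G : I -> F) :
  \sum_(i <- r) G i = \sum_(i <- r) (G i : {malg K[{fmonom _}]}).
Proof. by elim/big_rec2: _ => // i y1 y2 _ <-; rewrite free_addE. Qed.

Lemma free_actU v c w : free_act v << c *g w >> = c *: word_act w v.
Proof. by rewrite (free_actEw _ msuppU_le) big_seq_fset1 mcoeffUU. Qed.

Lemma word_actZ w c v : word_act w (c *: v) = c *: word_act w v.
Proof. by elim: w => //= t w ->; rewrite linearZ. Qed.

Lemma word_act_sum w (I : Type) (r : seq I) (G : I -> V) :
  word_act w (\sum_(i <- r) G i) = \sum_(i <- r) word_act w (G i).
Proof. by elim: w => //= t w ->; rewrite linear_sum. Qed.

Lemma free_actM v p q : free_act v (p * q) = free_act (free_act v q) p.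
Proof.
rewrite free_mulE malgME -free_sumE free_act_sum; apply: eq_bigr => w _ /=.
rewrite -free_sumE free_act_sum word_act_sum scaler_sumr.
apply: eq_bigr => u _ /=.
rewrite free_actU fmM word_actZ scalerA; congr (_ *: _).
by rewrite /word_act foldr_cat.
Qed.

Lemma free_act_gen v t : free_act v (free_gen K t) = gen_act t v.
Proof. by rewrite /free_gen -lock free_actU scale1r fmU. Qed.

Lemma free_act1 v : free_act v 1 = v.
Proof. by rewrite [LHS]free_actU scale1r fm1. Qed.

Lemma free_act_br v s t :
  free_act v (comm_br (free_gen K s) (free_gen K t))
  = gen_act s (gen_act t v) - gen_act t (gen_act s v).
Proof.
by rewrite free_actB 2!free_actM !free_act_gen.
Qed.

Lemma weyl_rel_act r v : weyl_rel r -> free_act v r = 0.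
Proof.
case=> i j; [by rewrite free_act_br XX subrr | by rewrite free_act_br YY subrr|].
rewrite free_actB free_act_br XY.
by case: (i == j); rewrite ?mulr0n ?mulr1n ?free_act1 ?free_act0 subrr.
Qed.

Lemma weyl_ideal_act (v : V) : v != 0 -> (1 : F) \notin weyl_ideal.
Proof.
move=> v0; apply/negP => /weyl_idealP I1.
have I0 : forall u, free_act u 1 = 0.
  apply: (I1 (fun p => forall u, free_act u p = 0)) => [|r Sr u]; last exact: weyl_rel_act.
  split=> [u|p q p0 q0 u|a b p p0 u]; first exact: free_act0.
    by rewrite free_actB p0 q0 subrr.
  rewrite !free_actM p0 /free_act big1 // => w _.
  have w0 : word_act w 0 = 0 by have := word_actZ w 0 0; rewrite !scale0r.
  by rewrite w0 scaler0.
by move: v0; rewrite -[v]free_act1 I0 eqxx.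
Qed.

End Action.

Lemma weyl_ideal1 : (1 : F) \notin weyl_ideal.
Proof.
have [V [X [Y [[v v0] XX YY XY]]]] := PolyRep.weyl_rep K n.
exact: weyl_ideal_act XX YY XY v v0.
Qed.

Definition weyl : Type := 
  Quotient.quot (GRing.ZmodClosed.clone F weyl_ideal _).
HB.instance Definition _ := Choice.on weyl.
HB.instance Definition _ := EqQuotient.on weyl.
HB.instance Definition _ := ZmodQuotient.on weyl.

Lemma weyl_eqP p q : reflect (\pi_weyl p = \pi_weyl q) (p - q \in weyl_ideal).
Proof. rewrite Quotient.idealrBE; exact: eqP. Qed.

Definition weyl_one : weyl := \pi_weyl 1.
Definition weyl_mul : weyl -> weyl -> weyl :=
  locked (fun a b => \pi_weyl (repr a * repr b)).
Definition weyl_scale : K -> weyl -> weyl :=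
  locked (fun c a => \pi_weyl (c *: repr a)).

Lemma weyl_reprP p : repr (\pi_weyl p) - p \in weyl_ideal.
Proof. by apply/weyl_eqP; rewrite reprK. Qed.

Lemma pi_weyl_mul p q : \pi_weyl (p * q) = weyl_mul (\pi_weyl p) (\pi_weyl q).
Proof.
rewrite /weyl_mul -lock; apply/esym/weyl_eqP; set p' := repr _; set q' := repr _.
have -> : p' * q' - p * q = (p' - p) * q' + p * (q' - q).
  by rewrite mulrBl mulrBr addrA subrK.
by apply: rpredD; [apply: weyl_idealMr | apply: weyl_idealMl]; exact: weyl_reprP.
Qed.

Lemma pi_weyl_scale c p : \pi_weyl (c *: p) = weyl_scale c (\pi_weyl p).
Proof.
rewrite /weyl_scale -lock; apply/esym/weyl_eqP.
by rewrite -scalerBr weyl_idealZ ?weyl_reprP.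
Qed.

Lemma weylP (P : weyl -> Prop) : (forall p, P (\pi_weyl p)) -> forall a, P a.
Proof. by move=> Ppi a; rewrite -[a]reprK. Qed.

Fact weyl_mulA : associative weyl_mul.
Proof.
elim/weylP=> p; elim/weylP=> q; elim/weylP=> r.
by rewrite -!pi_weyl_mul mulrA.
Qed.

Fact weyl_mul1 : left_id weyl_one weyl_mul.
Proof. by elim/weylP=> p; rewrite -pi_weyl_mul mul1r. Qed.

Fact weyl_mulr1 : right_id weyl_one weyl_mul.
Proof. by elim/weylP=> p; rewrite -pi_weyl_mul mulr1. Qed.

Fact weyl_mulDl : left_distributive weyl_mul +%R.
Proof.
elim/weylP=> p; elim/weylP=> q; elim/weylP=> r.
by rewrite -raddfD -!pi_weyl_mul -raddfD mulrDl.
Qed.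

Fact weyl_mulDr : right_distributive weyl_mul +%R.
Proof.
elim/weylP=> p; elim/weylP=> q; elim/weylP=> r.
by rewrite -raddfD -!pi_weyl_mul -raddfD mulrDr.
Qed.

Fact weyl_one_neq0 : weyl_one != 0.
Proof.
apply: contra weyl_ideal1 => /eqP e.
by rewrite -[1]subr0; apply/weyl_eqP; rewrite raddf0.
Qed.

HB.instance Definition _ := GRing.Zmodule_isNzRing.Build weyl
  weyl_mulA weyl_mul1 weyl_mulr1 weyl_mulDl weyl_mulDr weyl_one_neq0.

Fact weyl_scaleA c d a : weyl_scale c (weyl_scale d a) = weyl_scale (c * d) a.
Proof. by elim/weylP: a => p; rewrite -!pi_weyl_scale scalerA. Qed.

Fact weyl_scale1 : left_id 1 weyl_scale.
Proof. by elim/weylP=> p; rewrite -pi_weyl_scale scale1r. Qed.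

Fact weyl_scaleDr : right_distributive weyl_scale +%R.
Proof.
move=> c; elim/weylP=> p; elim/weylP=> q.
by rewrite -raddfD -!pi_weyl_scale -raddfD scalerDr.
Qed.

Fact weyl_scaleDl a : {morph weyl_scale^~ a : c d / c + d}.
Proof.
by elim/weylP: a => p c d; rewrite -!pi_weyl_scale -raddfD scalerDl.
Qed.

HB.instance Definition _ := GRing.Zmodule_isLmodule.Build K weyl
  weyl_scaleA weyl_scale1 weyl_scaleDr weyl_scaleDl.

Fact weyl_scaleAl (c : K) (a b : weyl) : c *: (a * b) = c *: a * b.
Proof.
elim/weylP: a b => p; elim/weylP=> q; rewrite /GRing.scale /GRing.mul /=.
by rewrite -!(pi_weyl_mul, pi_weyl_scale) scalerAl.
Qed.
HB.instance Definition _ := GRing.Lmodule_isLalgebra.Build K weyl weyl_scaleAl.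

Fact weyl_scaleAr (c : K) (a b : weyl) : c *: (a * b) = a * (c *: b).
Proof.
elim/weylP: a b => p; elim/weylP=> q; rewrite /GRing.scale /GRing.mul /=.
by rewrite -!(pi_weyl_mul, pi_weyl_scale) scalerAr.
Qed.
HB.instance Definition _ := GRing.Lalgebra_isAlgebra.Build K weyl weyl_scaleAr.

Definition weyl_pi (p : F) : weyl := \pi_weyl p.

Fact weyl_pi_zmod : zmod_morphism weyl_pi.
Proof. by move=> p q; rewrite /weyl_pi raddfB. Qed.
HB.instance Definition _ :=
  GRing.isZmodMorphism.Build F weyl weyl_pi weyl_pi_zmod.

Fact weyl_pi_monoid : monoid_morphism weyl_pi.
Proof. by split=> // p q; exact: pi_weyl_mul. Qed.
HB.instance Definition _ :=
  GRing.isMonoidMorphism.Build F weyl weyl_pi weyl_pi_monoid.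

Fact weyl_pi_scalable : scalable weyl_pi.
Proof. by move=> c p; exact: pi_weyl_scale. Qed.
HB.instance Definition _ :=
  GRing.isScalable.Build K F weyl *:%R weyl_pi weyl_pi_scalable.

Lemma weyl_piP p q : reflect (weyl_pi p = weyl_pi q) (p - q \in weyl_ideal).
Proof. exact: weyl_eqP. Qed.

Lemma weyl_ind (P : weyl -> Prop) : (forall p, P (weyl_pi p)) -> forall a, P a.
Proof. exact: weylP. Qed.

Definition weyl_x (i : 'I_n) : weyl := weyl_pi (free_x i).
Definition weyl_y (i : 'I_n) : weyl := weyl_pi (free_y i).

Definition weyl_relations (B : algType K) (u v : 'I_n -> B) : Prop :=
  [/\ forall i j, comm_br (u i) (u j) = 0,
      forall i j, comm_br (v i) (v j) = 0
    & forall i j, comm_br (u i) (v j) = (i == j)%:R].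

Lemma weyl_xyP : weyl_relations weyl_x weyl_y.
Proof.
have piE r : weyl_rel r -> weyl_pi r = 0.
  move=> Sr; rewrite -[RHS](raddf0 weyl_pi); apply/weyl_piP; rewrite subr0.
  by apply/weyl_idealP; exact: gen_ideal_sub.
have piC p q : comm_br (weyl_pi p) (weyl_pi q) = weyl_pi (comm_br p q).
  by rewrite /comm_br raddfB /= !rmorphM.
split=> i j; rewrite piC; [exact/piE/weyl_rel_xx | exact/piE/weyl_rel_yy |].
apply/eqP; rewrite -subr_eq0 -(rmorph_nat weyl_pi) -raddfB.
exact/eqP/piE/weyl_rel_xy.
Qed.

Section Lift.
Variables (B : algType K) (u v : 'I_n -> B).

Let gens (t : 'I_n + 'I_n) : B :=
  match t with inl i => u i | inr i => v i end.

(* The algebra morphism with x_i |-> u_i and y_i |-> v_i, see weyl_lift_x and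
   weyl_lift_y *)
Definition weyl_lift (uv : weyl_relations u v) (a : weyl) : B :=
  free_ev gens (repr a).

Variable uv : weyl_relations u v.

Lemma weyl_lift_pi p : weyl_lift uv (weyl_pi p) = free_ev gens p.
Proof.
suff ev0 q : gen_ideal weyl_rel q -> free_ev gens q = 0.
  by apply/eqP; rewrite -subr_eq0 -raddfB; apply/eqP/ev0/weyl_idealP/weyl_reprP.
move=> /(_ (fun q => free_ev gens q = 0)); apply.
  split=> [|p1 p2 e1 e2|a b r er]; first exact: raddf0.
    by rewrite raddfB /= e1 e2 subrr.
  by rewrite !rmorphM /= er mulr0 mul0r.
have [uu vv uvE] := uv.
have evC t t' : free_ev gens (comm_br (free_gen K t) (free_gen K t'))
    = comm_br (gens t) (gens t').
  by rewrite /comm_br raddfB /= !rmorphM /= !free_ev_gen.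
move=> r [] i j; [exact: etrans (evC (inl i) (inl j)) (uu i j)
  | exact: etrans (evC (inr i) (inr j)) (vv i j) |].
have e : free_ev gens (comm_br (free_x i) (free_y j)) = (i == j)%:R.
  exact: etrans (evC (inl i) (inr j)) (uvE i j).
have eN : free_ev gens (i == j)%:R = (i == j)%:R.
  exact: (rmorph_nat (free_ev gens)).
by rewrite (raddfB (free_ev gens)) /= e eN subrr.
Qed.

Fact weyl_lift_zmod : zmod_morphism (weyl_lift uv).
Proof.
elim/weyl_ind=> p; elim/weyl_ind=> q.
by rewrite -raddfB !weyl_lift_pi raddfB.
Qed.
HB.instance Definition _ :=
  GRing.isZmodMorphism.Build weyl B (weyl_lift uv) weyl_lift_zmod.

Fact weyl_lift_monoid : monoid_morphism (weyl_lift uv).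
Proof.
split; first by rewrite -(rmorph1 weyl_pi) weyl_lift_pi rmorph1.
elim/weyl_ind=> p; elim/weyl_ind=> q.
by rewrite -rmorphM !weyl_lift_pi rmorphM.
Qed.
HB.instance Definition _ :=
  GRing.isMonoidMorphism.Build weyl B (weyl_lift uv) weyl_lift_monoid.

Fact weyl_lift_scalable : scalable (weyl_lift uv).
Proof.
by move=> c; elim/weyl_ind=> p; rewrite -linearZ !weyl_lift_pi linearZ.
Qed.
HB.instance Definition _ :=
  GRing.isScalable.Build K weyl B *:%R (weyl_lift uv) weyl_lift_scalable.

Lemma weyl_lift_x i : weyl_lift uv (weyl_x i) = u i.
Proof. by rewrite weyl_lift_pi free_ev_gen. Qed.

Lemma weyl_lift_y i : weyl_lift uv (weyl_y i) = v i.
Proof. by rewrite weyl_lift_pi free_ev_gen. Qed.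

End Lift.

Section Alpha.
Variable k : 'rV[K]_n.

Definition shift_y (i : 'I_n) : weyl := weyl_y i + (k 0 i)%:A.

Fact weyl_shiftP : weyl_relations weyl_x shift_y.
Proof.
have [xx yy xy] := weyl_xyP.
have algC (c : K) (a : weyl) : c%:A * a = a * c%:A.
  by rewrite mulr_algl mulr_algr.
have brr (a b : weyl) c : comm_br a (b + c%:A) = comm_br a b.
  by rewrite /comm_br mulrDr mulrDl algC opprD addrACA subrr addr0.
have brl (a b : weyl) c : comm_br (a + c%:A) b = comm_br a b.
  by rewrite /comm_br mulrDr mulrDl algC opprD addrACA subrr addr0.
by split=> i j; rewrite ?brr ?brl.
Qed.

Definition weyl_alpha : {lrmorphism weyl -> weyl} := weyl_lift weyl_shiftP.

Lemma weyl_alpha_x i : weyl_alpha (weyl_x i) = weyl_x i.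
Proof. exact: weyl_lift_x. Qed.

Lemma weyl_alpha_y i : weyl_alpha (weyl_y i) = weyl_y i + (k 0 i)%:A.
Proof. exact: weyl_lift_y. Qed.

End Alpha.

End WeylAlgebra.

HB.mixin Record isHomAssoc (K : fieldType) V of GRing.Lmodule K V := {
  hmul : V -> V -> V;
  htwist : V -> V;
  hmul_linearl : forall b, linear (hmul^~ b);
  hmul_linearr : forall a, linear (hmul a);
  htwist_linear : linear htwist;
  hmul_hom_assoc : forall a b c,
    hmul (htwist a) (hmul b c) = hmul (hmul a b) (htwist c)
}.

#[short(type="homAssocType")]
HB.structure Definition HomAssoc (K : fieldType) :=
  {V of isHomAssoc K V & GRing.Lmodule K V}.

Section HomAssocMorphism.
Variables (K : fieldType) (A B : homAssocType K).

Definition hom_assoc_morphism (f : A -> B) : Prop :=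
  [/\ linear f,
      forall a b, f (hmul a b) = hmul (f a) (f b)
    & forall a, f (htwist a) = htwist (f a)].

Definition hom_assoc_isomorphism (f : A -> B) : Prop :=
  hom_assoc_morphism f /\ bijective f.

End HomAssocMorphism.

(* K-vector space A_n; the product and the twisting map depend on k. *)
Definition hom_weyl (K : fieldType) (n : nat) (k : 'rV[K]_n) : Type :=
  weyl K n.

Section HomWeyl.
Variables (K : fieldType) (n : nat) (k : 'rV[K]_n).
Local Notation hom_weyl := (hom_weyl k).

HB.instance Definition _ := GRing.Lmodule.copy hom_weyl (weyl K n).

Definition hom_weyl_mul (p q : hom_weyl) : hom_weyl :=
  weyl_alpha k ((p : weyl K n) * (q : weyl K n)).
Definition hom_weyl_twist (p : hom_weyl) : hom_weyl := weyl_alpha k p.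

Fact hom_weyl_linearl q : linear (hom_weyl_mul^~ q).
Proof.
by move=> c p p'; rewrite /hom_weyl_mul mulrDl -scalerAl linearP.
Qed.
Fact hom_weyl_linearr p : linear (hom_weyl_mul p).
Proof.
by move=> c q q'; rewrite /hom_weyl_mul mulrDr -scalerAr linearP.
Qed.
Fact hom_weyl_twist_linear : linear hom_weyl_twist.
Proof. by move=> c p q; rewrite /hom_weyl_twist linearP. Qed.
Fact hom_weyl_hom_assoc p q r :
  hom_weyl_mul (hom_weyl_twist p) (hom_weyl_mul q r)
  = hom_weyl_mul (hom_weyl_mul p q) (hom_weyl_twist r).
Proof. by rewrite /hom_weyl_mul /hom_weyl_twist -!rmorphM mulrA. Qed.

HB.instance Definition _ := isHomAssoc.Build K hom_weyl
  hom_weyl_linearl hom_weyl_linearr hom_weyl_twist_linear hom_weyl_hom_assoc.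

End HomWeyl.

Definition num_nonzero (K : fieldType) (n : nat) (k : 'rV[K]_n) : nat :=
  #|[set i | k 0 i != 0]|.

(* Main.v *)
(* For k = k' = 0 the hom-associative Weyl algebra is the Weyl algebra itself, so
   HDC with m = 0 contains DC. Conversely, alpha_k' is injective, so a morphism
   f : A_n^k -> A_n^k' is multiplicative for the associative products, and f 1 is
   an idempotent; since A_n is a domain, f 1 = 1 as soon as f is nonzero, and DC
   applies.
   That A_n is a domain follows from its commuting, locally nilpotent derivations
   [x_i, _] and [y_i, _]: if d^(k+1) a = 0 and d^(l+1) b = 0, then d^(k+l) (a b)
   is 'C(k+l, k) d^k a d^l b, so zero divisors can be pushed into the common
   kernel of these derivations. This kernel consists of scalars, because the Euler
   operator vanishes on it but acts on words of length d as multiplication by d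
   modulo shorter words. *)
Require Import Defs.
From HB Require Import structures.
From mathcomp Require Import all_boot all_order all_algebra.
From mathcomp Require Import finmap.
From mathcomp.multinomials Require Import monalg.

Set Implicit Arguments.
Unset Strict Implicit.
Unset Printing Implicit Defensive.

Import GRing.Theory.
Local Open Scope ring_scope.

(** * Inner derivations of an associative algebra *)

Section Commutator.
Variables (K : fieldType) (A : algType K).
Implicit Types a b c : A.

Fact comm_br_is_linear a : linear (comm_br a).
Proof.
move=> k b c; rewrite /comm_br mulrDr mulrDl -scalerAr -scalerAl scalerBr.
by rewrite opprD addrACA.
Qed.
HB.instance Definition _ a :=
  GRing.isLinear.Build K A A *:%R (comm_br a) (comm_br_is_linear a).

Lemma comm_brC a b : comm_br a b = - comm_br b a.
Proof. by rewrite /comm_br opprB. Qed.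

Lemma comm_brNl a b : comm_br (- a) b = - comm_br a b.
Proof. by rewrite /comm_br mulNr mulrN opprB opprK addrC. Qed.

Lemma comm_brM a b c : comm_br a (b * c) = comm_br a b * c + b * comm_br a c.
Proof. by rewrite /comm_br mulrBl mulrBr !mulrA addrA subrK. Qed.

Lemma comm_br_alg a (k : K) : comm_br a k%:A = 0.
Proof. by rewrite /comm_br mulr_algr mulr_algl subrr. Qed.

Lemma comm_br_jacobi a b c :
  comm_br a (comm_br b c) = comm_br (comm_br a b) c + comm_br b (comm_br a c).
Proof.
rewrite {2}/comm_br raddfB /= !comm_brM opprD [- _ - _]addrC.
by rewrite addrACA.
Qed.

Lemma iter_comm_br0 a m : iter m (comm_br a) 0 = 0.
Proof. by elim: m => //= m ->; rewrite raddf0. Qed.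

Lemma iter_comm_brD a b c m :
  iter m (comm_br a) (b + c) = iter m (comm_br a) b + iter m (comm_br a) c.
Proof. by elim: m => //= m ->; rewrite raddfD. Qed.

Lemma iter_comm_brZ a k b m :
  iter m (comm_br a) (k *: b) = k *: iter m (comm_br a) b.
Proof. by elim: m => //= m ->; rewrite linearZ. Qed.

(** In the Leibniz expansion every other term differentiates [b] more than [k] times or [c] more
    than [l] times. The double induction avoids the full expansion: Pascal's rule adds up the two
    summands. *)
Lemma iter_comm_br_top a b c k l :
    iter k.+1 (comm_br a) b = 0 -> iter l.+1 (comm_br a) c = 0 ->
  iter (k + l) (comm_br a) (b * c)
  = (iter k (comm_br a) b * iter l (comm_br a) c) *+ 'C(k + l, k).
Proof.
elim: k l b c => [|k IHk] l b c b0.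
  rewrite bin0 /= in b0 * => _; elim: l => //= l ->.
  by rewrite comm_brM b0 mul0r add0r.
elim: l c => [|l IHl] c c0.
  rewrite /= in c0; rewrite addn0 binn {b0}; elim: k.+1 => //= m ->.
  by rewrite comm_brM c0 mulr0 addr0.
have b1 : iter k.+1 (comm_br a) (comm_br a b) = 0 by rewrite -iterSr.
have c1 : iter l.+1 (comm_br a) (comm_br a c) = 0 by rewrite -iterSr.
rewrite addnS iterSr comm_brM iter_comm_brD IHl // addSnnS IHk // -!iterSr.
by rewrite -mulrnDr binS addnC.
Qed.

(** By the Jacobi identity the two derivations commute, since the bracket with a scalar vanishes. *)
Lemma iter_comm_br_comm a b c (k : K) m :
  comm_br a b = k%:A ->
  comm_br b (iter m (comm_br a) c) = iter m (comm_br a) (comm_br b c).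
Proof.
move=> ab; elim: m => //= m <-; rewrite comm_br_jacobi [comm_br b a]comm_brC ab.
by rewrite -scaleNr [comm_br _%:A _]comm_brC comm_br_alg oppr0 add0r.
Qed.
End Commutator.

(** * Algebras whose generators have scalar commutators *)

Section WeylSystem.
Variables (K : fieldType) (A : algType K) (T : finType) (g h : T -> A).
Hypothesis K_char0 : [pchar K] =i pred0.
Hypothesis g_gen : forall P : A -> Prop, P 1 ->
  (forall c a b, P a -> P b -> P (c *: a + b)) ->
  (forall t a, P a -> P (g t * a)) -> forall a, P a.
Hypothesis gg_scalar : forall s t, exists c : K, comm_br (g s) (g t) = c%:A.
Hypothesis hg_scalar : forall s t, exists c : K, comm_br (h s) (g t) = c%:A.
(** Duality of [h] and [g]: the Euler operator fixes every generator. *)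
Hypothesis gh_dual : forall s, \sum_t h t * comm_br (g t) (g s) = g s.

Lemma mulrn_eq0_char0 (a : A) m : (0 < m)%N -> a *+ m = 0 -> a = 0.
Proof.
move=> m0 /eqP; rewrite -scaler_nat scaler_eq0 => /orP[|/eqP //].
by rewrite ((pcharf0P K).1 K_char0) eqn0Ngt m0.
Qed.

(** Left multiplication by a generator raises the order of nilpotency by at most one, because
    [comm_br (g t) (g s)] is a scalar. *)
Lemma comm_br_nilpotent t a : exists m, iter m (comm_br (g t)) a = 0.
Proof.
elim/g_gen: a => [|c a b [m am] [l bl]|s a [m am]].
- by exists 1%N; rewrite /= -[1]scale1r comm_br_alg.
- exists (m + l)%N; rewrite iter_comm_brD iter_comm_brZ {1}addnC !iterD.
  by rewrite am bl !iter_comm_br0 scaler0 addr0.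
exists m.+1; have [c gc] := gg_scalar t s.
elim: m a am => [|m IHm] a am; first by rewrite [a]am mulr0 iter_comm_br0.
rewrite iterSr comm_brM gc mulr_algl iter_comm_brD iter_comm_brZ am scaler0.
by rewrite add0r IHm // -iterSr.
Qed.

Lemma comm_br_top t a : a != 0 ->
  exists m, iter m (comm_br (g t)) a != 0 /\ iter m.+1 (comm_br (g t)) a = 0.
Proof.
move=> a0; have ex : exists m, iter m (comm_br (g t)) a == 0.
  by have [m /eqP] := comm_br_nilpotent t a; exists m.
case: (ex_minnP ex) => -[|m] /eqP am min; first by rewrite [a]am eqxx in a0.
by exists m; split=> //; apply/negP => /min; rewrite ltnn.
Qed.

(** For each generator in turn, both factors are replaced by their last nonzero derivatives.
    Conditions obtained for earlier generators survive because the derivations commute. *)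
Lemma comm_br_constants (s : seq T) (a b : A) :
    a != 0 -> b != 0 -> a * b = 0 ->
  exists a' b', [/\ a' != 0, b' != 0, a' * b' = 0
    & {in s, forall t, comm_br (g t) a' = 0 /\ comm_br (g t) b' = 0}].
Proof.
move=> a0 b0 ab; elim: s => [|t s [a' [b' [a'0 b'0 ab' ker_s]]]].
  by exists a, b; split.
have [k [ak ak1]] := comm_br_top t a'0; have [l [bl bl1]] := comm_br_top t b'0.
exists (iter k (comm_br (g t)) a'), (iter l (comm_br (g t)) b').
split=> // [|r].
  (* The derivative of order [k + l] of [a' * b' = 0] is a binomial multiple of the new product, and
     that coefficient is invertible in characteristic zero. *)
  have := iter_comm_br_top ak1 bl1; rewrite ab' iter_comm_br0 => /esym.
  by apply: mulrn_eq0_char0; rewrite bin_gt0 leq_addr.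
rewrite inE => /orP[/eqP -> //|/ker_s[ar br]].
have [c gc] := gg_scalar t r.
by rewrite !(iter_comm_br_comm _ _ gc) ar br !iter_comm_br0.
Qed.

(* The span of the words in [g] of length less than [d], so [d = 0] gives [0]
   and [d = 1] gives the scalars. *)
Fixpoint word_filt d (a : A) : Prop :=
  if d is d'.+1 then
    exists (c : K) (b : T -> A),
      (forall t, word_filt d' (b t)) /\ a = c%:A + \sum_t g t * b t
  else a = 0.

Lemma word_filt0 d : word_filt d 0.
Proof.
elim: d => //= d IHd; exists 0, (fun=> 0); split=> //.
by rewrite scale0r add0r big1 // => t _; rewrite mulr0.
Qed.

Lemma word_filtP d c a b :
  word_filt d a -> word_filt d b -> word_filt d (c *: a + b).
Proof.
elim: d a b => [a b -> ->|d IHd a b [x [u [uP ->]]] [y [v [vP ->]]]] /=.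
  by rewrite scaler0 addr0.
exists (c * x + y), (fun t => c *: u t + v t); split=> [t|]; first exact: IHd (uP t) (vP t).
rewrite scalerDr scaler_sumr addrACA scalerA -scalerDl -big_split.
by congr (_ + _); apply: eq_bigr => t _; rewrite mulrDr scalerAr.
Qed.

Lemma word_filtD d a b : word_filt d a -> word_filt d b -> word_filt d (a + b).
Proof. by move=> fa fb; rewrite -[a]scale1r; apply: word_filtP. Qed.

Lemma word_filtZ d c a : word_filt d a -> word_filt d (c *: a).
Proof. by move=> fa; rewrite -[_ *: _]addr0; apply: word_filtP (word_filt0 d). Qed.

Lemma word_filt_sum d (F : T -> A) :
  (forall t, word_filt d (F t)) -> word_filt d (\sum_t F t).
Proof.
move=> FP; elim/big_ind: _ => //; [exact: word_filt0 | exact: word_filtD].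
Qed.

Lemma word_filtM d t a : word_filt d a -> word_filt d.+1 (g t * a).
Proof.
move=> fa; exists 0, (fun s => if s == t then a else 0); split=> [s|].
  by case: ifP => // _; exact: word_filt0.
rewrite scale0r add0r (bigD1 t) //= eqxx big1 ?addr0 // => s /negPf ->.
by rewrite mulr0.
Qed.

Lemma word_filt_alg d c : word_filt d.+1 c%:A.
Proof.
exists c, (fun=> 0); split=> [t|]; first exact: word_filt0.
by rewrite big1 ?addr0 // => t _; rewrite mulr0.
Qed.

Lemma word_filtS d a : word_filt d a -> word_filt d.+1 a.
Proof.
elim: d a => [a ->|d IHd a [c [b [bP ->]]]]; first exact: word_filt0.
by exists c, b; split=> // t; exact: IHd (bP t).
Qed.

Lemma word_filt_full a : exists d, word_filt d a.
Proof.
have filt_add d e b : word_filt d b -> word_filt (e + d) b.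
  by move=> fb; elim: e => //= e; exact: word_filtS.
elim/g_gen: a => [|c a b [d fa] [e fb]|t a [d fa]].
- by exists 1%N; rewrite -[1]scale1r; exact: word_filt_alg.
- by exists (d + e)%N; apply: word_filtP; [rewrite addnC|]; exact: filt_add.
- by exists d.+1; exact: word_filtM.
Qed.

(** The bracket replaces one letter at a time by a scalar, so words do not get longer. *)
Lemma word_filt_comm_br z d a :
    (forall t, exists c : K, comm_br z (g t) = c%:A) ->
  word_filt d a -> word_filt d (comm_br z a).
Proof.
move=> zg; elim: d a => [a ->|d IHd a [c [b [bP ->]]]].
  by rewrite raddf0; exact: word_filt0.
have -> : comm_br z (c%:A + \sum_t g t * b t) = \sum_t comm_br z (g t * b t).
  by rewrite raddfD /= comm_br_alg add0r raddf_sum.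
apply: word_filt_sum => t.
have [x zgt] := zg t.
rewrite comm_brM zgt mulr_algl; apply: word_filtP; first exact/word_filtS/bP.
exact/word_filtM/IHd/bP.
Qed.

(* For the Weyl algebra this is the operator sum_i y_i [x_i, _] - x_i [y_i, _],
   which multiplies a word by its length, up to shorter words. *)
Definition euler (a : A) : A := \sum_t h t * comm_br (g t) a.

Lemma euler_word_filt d a : word_filt d.+1 a -> word_filt d (euler a - a *+ d).
Proof.
have eulerD b c : euler (b + c) = euler b + euler c.
  by rewrite -big_split; apply: eq_bigr => t _; rewrite raddfD mulrDr.
have euler0 : euler 0 = 0 by rewrite /euler big1 // => t _; rewrite raddf0 mulr0.
have euler_alg c : euler c%:A = 0.
  by rewrite /euler big1 // => t _; rewrite comm_br_alg mulr0.
elim: d a => [a [c [b [/= bP ->]]]|d IHd a [c [b [bP ->]]]].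
  rewrite mulr0n subr0 big1 ?addr0 ?euler_alg // => t _.
  by rewrite bP mulr0.
rewrite eulerD euler_alg add0r (big_morph euler eulerD euler0).
rewrite mulrnDl opprD addrCA -mulNrn -scaleNr; apply: word_filtD.
  by rewrite -scaler_nat scalerA; exact: word_filt_alg.
rewrite -sumrMnl -sumrB; apply: word_filt_sum => t.
(* The last sum measures how far [euler] is from a derivation. Its coefficients are scalars, so it
   is of lower order than [g t * b t]. *)
have -> : euler (g t * b t) = g t * euler (b t) + g t * b t
    + \sum_s comm_br (h s) (g t) * comm_br (g s) (b t).
  rewrite -[in X in _ + X + _](gh_dual t) /euler mulr_suml mulr_sumr.
  rewrite -!big_split; apply: eq_bigr => s _ /=.
  rewrite comm_brM mulrDr !mulrA [comm_br (h s) _]/comm_br mulrBl addrC.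
  by rewrite addrA subrK addrC.
rewrite mulrS opprD addrAC [_ + (_ - _)]addrA addrK -mulrnAr -mulrBr.
apply: word_filtD; first exact/word_filtM/IHd/bP.
apply: word_filt_sum => s; have [x ->] := hg_scalar s t.
by rewrite mulr_algl; apply/word_filtZ/word_filt_comm_br/bP => r; exact: gg_scalar.
Qed.

(** As [euler a = 0], some multiple of [a] lies one filtration step lower; dividing by the
    multiplier and descending ends at the scalars. *)
Lemma comm_br_ker_scalar a :
  (forall t, comm_br (g t) a = 0) -> exists c : K, a = c%:A.
Proof.
move=> ga; have Ea : euler a = 0.
  by rewrite /euler big1 // => t _; rewrite ga mulr0.
have [d] := word_filt_full a; elim: d => [->|[_ [c [b [/= b0 ->]]]|d IHd fa]].
(* The levels 0 and 1 are settled directly; from level [d.+2] the multiplier is [d.+1], which is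
   nonzero in [K]. *)
- by exists 0; rewrite scale0r.
- by exists c; rewrite big1 ?addr0 // => t _; rewrite b0 mulr0.
apply: IHd; have := euler_word_filt fa.
rewrite Ea add0r -scaler_nat -scaleNr => /(word_filtZ (- d.+1%:R^-1)).
rewrite scalerA mulrNN mulVf ?scale1r //.
by rewrite ((pcharf0P K).1 K_char0).
Qed.

Lemma weyl_system_domain (a b : A) : a * b = 0 -> (a == 0) || (b == 0).
Proof.
move=> ab; have [//|a0] := eqVneq a 0; have [//|b0] := eqVneq b 0.
have [a' [b' [a'0 b'0 ab' ker]]] := comm_br_constants (enum T) a0 b0 ab.
have [|x ax] := @comm_br_ker_scalar a'.
  by move=> t; case: (ker t) => //; rewrite mem_enum.
have [|y bY] := @comm_br_ker_scalar b'.
  by move=> t; case: (ker t) => //; rewrite mem_enum.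
move: a'0 b'0 ab'; rewrite ax bY mulr_algl scalerA => /negP x0 /negP y0 /eqP.
by rewrite scaler_eq0 mulf_eq0 oner_eq0 orbF => /orP[]/eqP z;
   [case: x0 | case: y0]; rewrite z scale0r.
Qed.
End WeylSystem.

(** * Induction over the free algebra *)

Section FreeAlgebra.
Variables (K : fieldType) (T : choiceType).

Lemma free_alg_gen_ind (P : free_alg K T -> Prop) :
    P 1 -> (forall c p q, P p -> P q -> P (c *: p + q)) ->
    (forall t p, P p -> P (free_gen K t * p)) ->
  forall p, P p.
Proof.
move=> P1 PD PM p.
have P0 : P 0 by have := PD (-1) _ _ P1 P1; rewrite scaleN1r addNr.
(* Words are built by adding letters on the left; linear combinations of words then exhaust the
   algebra. *)
have Pword (w : {fmonom T}) : P (<< w >> : {malg K[{fmonom T}]}).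
  case: w; elim=> [|t s IHs].
    by have -> : FMonom [::] = mone :> {fmonom T} by apply: val_inj; rewrite /= fm1.
  have -> : FMonom (t :: s) = mmul (fmu t) (FMonom s).
    by apply: val_inj; rewrite /= fmM fmU.
  have := PM t _ IHs; congr P; rewrite free_mulE /free_gen -lock.
  by rewrite malgM_def fgmulUU mulr1.
have ZU c (w : {fmonom T}) :
    << c *g w >> = c *: (<< w >> : {malg K[{fmonom T}]}).
  by apply/malgP => u; rewrite mcoeffZ !mcoeffU mulr_natr.
rewrite -[p]/(p : {malg K[{fmonom T}]}) [p]monalgE.
elim: (finmap.enum_fset _) => [|w s IHs]; first by rewrite big_nil.
rewrite big_cons.
have := PD p@_w _ _ (Pword w) IHs; congr P.
rewrite free_addE free_scaleE.
exact: (congr1 (fun q : {malg K[{fmonom T}]} => q + _) (esym (ZU _ _))).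
Qed.
End FreeAlgebra.

(** * The Weyl algebra: domain property and shift automorphisms *)

Section Weyl.
Variables (K : fieldType) (n : nat).
Local Notation W := (weyl K n).

Definition weyl_gen (t : 'I_n + 'I_n) : W :=
  match t with inl i => weyl_x K i | inr i => weyl_y K i end.

Lemma weyl_gen_ind (P : W -> Prop) :
    P 1 -> (forall c a b, P a -> P b -> P (c *: a + b)) ->
    (forall t a, P a -> P (weyl_gen t * a)) ->
  forall a, P a.
Proof.
move=> P1 PD PM; apply: weyl_ind; apply: free_alg_gen_ind => [|c p q Pp Pq|t p Pp].
- by rewrite rmorph1.
- by rewrite linearP; apply: PD.
- by rewrite rmorphM; case: t => i; [exact: (PM (inl i)) | exact: (PM (inr i))].
Qed.

Lemma weyl_lrmorphism_ext (B : algType K) (f g : {lrmorphism W -> B}) :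
    (forall i, f (weyl_x K i) = g (weyl_x K i)) ->
    (forall i, f (weyl_y K i) = g (weyl_y K i)) ->
  f =1 g.
Proof.
move=> fgx fgy; apply: weyl_gen_ind => [|c a b fa fb|t a fa].
- by rewrite !rmorph1.
- by rewrite !linearP /= fa fb.
- by rewrite !rmorphM /= fa; case: t => i /=; rewrite ?fgx ?fgy.
Qed.

Lemma weyl_domain (a b : W) :
  [pchar K] =i pred0 -> a * b = 0 -> (a == 0) || (b == 0).
Proof.
move=> K_char0; have [xx yy xy] := weyl_xyP K n.
have yx (i j : 'I_n) : comm_br (weyl_y K i) (weyl_x K j) = (- (j == i)%:R)%:A.
  by rewrite comm_brC xy scaleNr scaler_nat.
have nat_scalar (m : nat) : exists c : K, m%:R = c%:A :> W.
  by exists m%:R; rewrite scaler_nat.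
have zero_scalar : exists c : K, 0 = c%:A :> W by exists 0; rewrite scale0r.
(* The sign compensates for [[y_i, x_i] = -1], so that both kinds of generators are fixed by the
   Euler operator. *)
pose h t : W := match t with inl i => weyl_y K i | inr i => - weyl_x K i end.
apply: (@weyl_system_domain _ _ _ weyl_gen h) => //; first exact: weyl_gen_ind.
- by case=> i [] j /=; rewrite ?xx ?yy ?xy ?yx //; eexists.
- case=> i [] j /=; rewrite ?comm_brNl ?xx ?yy ?xy ?yx ?oppr0 //; first by eexists.
  by exists (- (i == j)%:R); rewrite scaleNr scaler_nat.
case=> j /=; rewrite big_sumType /=.
  rewrite big1 ?add0r => [|i _]; last by rewrite xx mulr0.
  rewrite (bigD1 j) //= big1 ?addr0 => [|i ij].
    by rewrite yx eqxx scaleN1r mulrNN mulr1.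
  by rewrite yx eq_sym (negPf ij) oppr0 scale0r mulr0.
rewrite addrC big1 ?add0r => [|i _]; last by rewrite yy mulr0.
rewrite (bigD1 j) //= big1 ?addr0 => [|i ij]; first by rewrite xy eqxx mulr1.
by rewrite xy (negPf ij) mulr0.
Qed.

Lemma weyl_alpha0 : weyl_alpha (0 : 'rV[K]_n) =1 id.
Proof.
apply: (@weyl_lrmorphism_ext _ (weyl_alpha 0) idfun) => i.
  exact: weyl_alpha_x.
by rewrite weyl_alpha_y mxE scale0r addr0.
Qed.

(** The opposite shift undoes the twist on generators; this supplies the injectivity that lets
    twists be cancelled. *)
Lemma weyl_alphaK (k : 'rV[K]_n) : cancel (weyl_alpha k) (weyl_alpha (- k)).
Proof.
apply: (@weyl_lrmorphism_ext _ (weyl_alpha (- k) \o weyl_alpha k) idfun) => i /=.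
  by rewrite !weyl_alpha_x.
rewrite weyl_alpha_y raddfD /= linearZ rmorph1 weyl_alpha_y mxE scaleNr.
by rewrite subrK.
Qed.
End Weyl.

(** * The equivalence of the two conjectures *)

Theorem proposition7 (K : fieldType) (n : nat) (K_char0 : [pchar K] =i pred0)
    (n_ge1 : (1 <= n)%N) :
  (forall f : {lrmorphism weyl K n -> weyl K n}, bijective f)
  <->
  (forall m : nat, (m <= n)%N ->
   forall k k' : 'rV[K]_n, num_nonzero k = m -> num_nonzero k' = m ->
   forall f : hom_weyl k -> hom_weyl k',
     hom_assoc_morphism f -> (exists p, f p != 0) ->
     hom_assoc_isomorphism f).
Proof.
split=> [DC m _ k k' _ _ f homf [p fp]|HDC f].
  split=> //; have [flin fmul _] := homf.
  (* The same map, read between the associative algebras. *)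
  pose F : weyl K n -> weyl K n := f.
  have FM a b : F (a * b) = F a * F b.
    have ftw (c : weyl K n) : F (weyl_alpha k c) = weyl_alpha k' (F c).
      by have [_ _ ftw] := homf; exact: ftw.
    (* After applying the twist of [k'], both sides become the image under [f] of the twisted
       product. *)
    by apply: (can_inj (weyl_alphaK k')); rewrite -ftw; exact: fmul.
  have F1 : F 1 = 1.
    have : F 1 * (F 1 - 1) = 0 by rewrite mulrBr mulr1 -FM mulr1 subrr.
    move/(weyl_domain K_char0); rewrite subr_eq0 => /orP[/eqP F1|/eqP //].
    by case/negP: fp; rewrite -[f p]/(F p) -[p]mulr1 FM F1 mulr0.
  pose G : {lrmorphism weyl K n -> weyl K n} := HB.pack F
    (GRing.isLinear.Build K (weyl K n) (weyl K n) *:%R F flin)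
    (GRing.isMonoidMorphism.Build (weyl K n) (weyl K n) F (conj F1 FM)).
  exact: (DC G).
have num0 : num_nonzero (0 : 'rV[K]_n) = 0%N.
  by apply: eq_card0 => i; rewrite inE mxE eqxx.
apply: (proj2 (HDC 0%N (leq0n n) 0 0 num0 num0 f _ _)).
- split=> [c a b|a b|a]; first exact: linearP.
    by rewrite /hmul /= /hom_weyl_mul !weyl_alpha0; exact: rmorphM.
  by rewrite /htwist /= /hom_weyl_twist !weyl_alpha0.
by exists 1; rewrite rmorph1 oner_eq0.
Qed.
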